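(* For all non-negative integers $n,m,p$, \[ \sum_{k=0}^{m}B_{n,p}(k+1)=\frac{B_{n+1}(m+1)-B_{n+1}}{n+1}+\frac{p+1}{p+2}\left(B_{n,p+1}(m+1)-B_{n,p+1}\right). \] In particular, for $p=0$, \[ \sum_{k=0}^{m}\left[B_{n}(k+1)+n\,k^{n}\right]=(m+1)\,B_{n}(m+1). \]
   Context: The Bernoulli polynomials are defined by $\sum_{n\ge0}B_n(x)\frac{t^n}{n!}=\frac{te^{xt}}{e^t-1}$ and $B_n=B_n(0)$. For each integer $p\geq 0$, the $p$-Bernoulli numbers $B_{n,p}$ are defined by $B_{0,p}=1$ and $B_{n+1,p}=pB_{n,p}-\frac{(p+1)^{2}}{p+2}B_{n,p+1}$ ($n,p\ge 0$), and the $p$-Bernoulli polynomials by $B_{n,p}(x)=\sum_{k=0}^{n}\binom{n}{k}x^{n-k}B_{k,p}$; for $p=0$ these are $B_{n,0}(x)=B_n(x)$. The convention $0^0=1$ is used. *)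

(* Defs.v *)
From mathcomp Require Import all_boot all_order all_algebra.
Set Implicit Arguments.
Unset Strict Implicit.
Unset Printing Implicit Defensive.
Import GRing.Theory.
Local Open Scope ring_scope.

(* A formal power series \sum_n f_n t^n is encoded by its coefficient
   sequence f : nat -> R. *)
Definition fps (R : comUnitRingType) : Type := nat -> R.

Definition fps_mul (R : comUnitRingType) (f g : fps R) : fps R :=
  fun n => \sum_(i < n.+1) f i * g (n - i)%N.

(* The first n coefficients of f / g by long division; meaningful when the
   constant term g_0 is a unit (see fps_divK). *)
Fixpoint fps_div_coefs (R : comUnitRingType) (f g : fps R) (n : nat) : seq R :=
  if n is k.+1 then
    let q := fps_div_coefs f g k in
    rcons q ((f k - \sum_(i < k) q`_i * g (k - i)%N) / g 0%N)
  else [::].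

Definition fps_div (R : comUnitRingType) (f g : fps R) : fps R :=
  fun n => (fps_div_coefs f g n.+1)`_n.

Definition fps_exp_tX : fps {poly rat} := fun n => (n`!%:R : rat)^-1 *: 'X^n.

Definition fps_expm1 : fps {poly rat} :=
  fun n => if n is 0 then 0 else ((n`!%:R : rat)^-1)%:P.

Definition fps_t : fps {poly rat} := fun n => (n == 1)%:R.

(* (e^t - 1) / t *)
Definition fps_expm1_over_t : fps {poly rat} := fun n => fps_expm1 n.+1.

(* B_n(x)/n! is the coefficient of t^n in t e^{xt} / (e^t - 1); since e^t - 1
   has no constant term, a factor t is cancelled before dividing.
   The uncancelled identity is bernoulli_poly_egf. *)
Definition bernoulli_poly (n : nat) : {poly rat} :=
  (n`!%:R : rat) *: fps_div fps_exp_tX fps_expm1_over_t n.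

Definition bernoulli (n : nat) : rat := (bernoulli_poly n).[0].

Fixpoint pbernoulli (n p : nat) : rat :=
  if n is k.+1 then
    p%:R * pbernoulli k p - p.+1%:R ^+ 2 / p.+2%:R * pbernoulli k p.+1
  else 1.

Definition pbernoulli_poly (n p : nat) : {poly rat} :=
  \sum_(k < n.+1) ('C(n, k)%:R * pbernoulli k p) *: 'X^(n - k).

Lemma size_fps_div_coefs (R : comUnitRingType) (f g : fps R) n :
  size (fps_div_coefs f g n) = n.
Proof. by elim: n => //= n IHn; rewrite size_rcons IHn. Qed.

Lemma nth_fps_div_coefs (R : comUnitRingType) (f g : fps R) n i :
  (i < n)%N -> (fps_div_coefs f g n)`_i = fps_div f g i.
Proof.
elim: n => // n IHn; rewrite ltnS leq_eqVlt => /predU1P[-> //|lt_in].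
by rewrite /= nth_rcons size_fps_div_coefs lt_in IHn.
Qed.

Lemma fps_divK (R : comUnitRingType) (f g : fps R) :
  g 0%N \is a GRing.unit -> fps_mul (fps_div f g) g =1 f.
Proof.
move=> g0U n; rewrite /fps_mul big_ord_recr /= subnn {2}/fps_div /=.
rewrite nth_rcons size_fps_div_coefs ltnn eqxx divrK // addrC.
under [X in _ - X + _]eq_bigr => i _ do rewrite nth_fps_div_coefs //.
by rewrite subrK.
Qed.

Lemma bernoulli_poly_egf :
  fps_mul fps_expm1 (fun n => (n`!%:R : rat)^-1 *: bernoulli_poly n)
  =1 fps_mul fps_t fps_exp_tX.
Proof.
have fact_neq0 n : (n`!%:R : rat) != 0.
  by rewrite Num.Theory.pnatr_eq0 -lt0n fact_gt0.
have egfE n : (n`!%:R : rat)^-1 *: bernoulli_poly n =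
    fps_div fps_exp_tX fps_expm1_over_t n.
  by rewrite /bernoulli_poly scalerA mulVf // scale1r.
case=> [|n]; first by rewrite /fps_mul !big_ord1 /= !mul0r.
rewrite /fps_mul big_ord_recl [RHS]big_ord_recl /= !mul0r !add0r.
rewrite [RHS]big_ord_recl /= mul1r subSS subn0 [X in _ + X]big1 => [|i _].
  rewrite addr0 -(@fps_divK _ fps_exp_tX fps_expm1_over_t _ n); last first.
    by rewrite /fps_expm1_over_t /= invr1 unitr1.
  rewrite /fps_mul (reindex_inj rev_ord_inj) /=; apply: eq_bigr => i _.
  rewrite egfE mulrC; congr (fps_div _ _ _ * _).
  by rewrite /bump /= add1n !subSS subKn // -ltnS.
by rewrite mul0r.
Qed.

(* Main.v *)
(* Both parts telescope.  The generating function gives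
   B_{n+1}(x+1) - B_{n+1}(x) = (n+1) x^n, which settles the second part and
   reduces the first one to D_{n,p}(x) = 0, where
     D_{n,p}(x) = B_{n,p}(x+1) - x^n
                  - (p+1)/(p+2) (B_{n,p+1}(x+1) - B_{n,p+1}(x)).
   The recurrence of the p-Bernoulli numbers lifts to
     B_{n+1,p}(x) = (x+p) B_{n,p}(x) - (p+1)^2/(p+2) B_{n,p+1}(x),
   whence D_{n+1,p} = (x+p+1) D_{n,p} - (p+1) D_{n,p+1}, and D vanishes by
   induction on n. *)
Require Import Defs.
From mathcomp Require Import all_boot all_order all_algebra.
From mathcomp Require Import ring.
Import GRing.Theory.
Local Open Scope ring_scope.

Lemma natrS_neq0 (n : nat) : n.+1%:R != 0 :> rat.
Proof. by rewrite Num.Theory.pnatr_eq0. Qed.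

Lemma fact_rat_neq0 (n : nat) : n`!%:R != 0 :> rat.
Proof. by rewrite Num.Theory.pnatr_eq0 -lt0n fact_gt0. Qed.

(** By strong induction: once the lower coefficients agree, the coefficients of order [n] differ
    only in the term with the unit [g 0]. *)
Lemma fps_mulIr (R : comUnitRingType) (g f1 f2 : fps R) :
  g 0 \is a GRing.unit -> fps_mul f1 g =1 fps_mul f2 g -> f1 =1 f2.
Proof.
move=> g0U eq_fg n; elim/ltn_ind: n => n IHn.
have := eq_fg n; rewrite /fps_mul !big_ord_recr /= subnn.
rewrite (eq_bigr (fun i : 'I_n => f2 i * g (n - i)%N)) => [|i _].
  by move/addrI/(mulIr g0U).
by rewrite IHn.
Qed.

(** Coefficient of t^n in G(t) (e^t - 1)/t = e^{xt}, where G is the generating function of the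
    B_i(x). *)
Lemma sum_bernoulli_poly (n : nat) (x : rat) :
  \sum_(i < n.+1) (i`!%:R)^-1 * (bernoulli_poly i).[x] * ((n - i).+1`!%:R)^-1
  = (n`!%:R)^-1 * x ^+ n.
Proof.
have E0U : fps_expm1_over_t 0 \is a GRing.unit.
  by rewrite /fps_expm1_over_t /= invr1 unitr1.
have := fps_divK fps_exp_tX E0U n.
move/(congr1 (horner_eval x)); rewrite /fps_mul rmorph_sum /= /horner_eval.
rewrite /fps_exp_tX hornerZ hornerXn => <-; apply: eq_bigr => i _.
rewrite /bernoulli_poly hornerM hornerC hornerZ mulrA mulVf ?mul1r //.
exact: fact_rat_neq0.
Qed.

(** Coefficient of t^n in e^{(x+1)t} = e^{xt} e^t. *)
Lemma exprD1_egf (n : nat) (x : rat) :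
  (n`!%:R)^-1 * (x + 1) ^+ n
  = \sum_(i < n.+1) (i`!%:R)^-1 * x ^+ i * ((n - i)`!%:R)^-1.
Proof.
rewrite addrC exprDn mulr_sumr; apply: eq_bigr => i _.
have le_in : (i <= n)%N by rewrite -ltnS.
rewrite expr1n mul1r -mulr_natl -(bin_fact le_in) !natrM.
have := fact_rat_neq0 i; have := fact_rat_neq0 (n - i).
have : 'C(n, i)%:R != 0 :> rat by rewrite Num.Theory.pnatr_eq0 -lt0n bin_gt0.
by move=> *; field; apply/and3P; split.
Qed.

Lemma bernoulli_poly_diff (n : nat) (x : rat) :
  (bernoulli_poly n).[x + 1] - (bernoulli_poly n).[x] = n%:R * x ^+ n.-1.
Proof.
(* [d], [v] and [e] encode G(x+1) - G(x), t e^{xt} and (e^t - 1)/t. Both [d] and [v] times [e] give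
   e^{xt}(e^t - 1), and [e] cancels. *)
pose d i := (i`!%:R)^-1 * ((bernoulli_poly i).[x + 1] - (bernoulli_poly i).[x]).
pose v i : rat := if i is j.+1 then (j`!%:R)^-1 * x ^+ j else 0.
pose e i : rat := (i.+1`!%:R)^-1.
have dv : d =1 v.
  apply: (@fps_mulIr rat e) => [|{}n]; first by rewrite /e invr1 unitr1.
  transitivity ((n`!%:R)^-1 * (x + 1) ^+ n - (n`!%:R)^-1 * x ^+ n).
    rewrite -!sum_bernoulli_poly -sumrB; apply: eq_bigr => i _.
    by rewrite /d mulrBr mulrBl.
  rewrite exprD1_egf big_ord_recr /= subnn invr1 mulr1 addrK.
  rewrite /fps_mul big_ord_recl mul0r add0r; apply: eq_bigr => i _.
  by rewrite lift0 /= /e subnSK.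
have := congr1 (fun y => n`!%:R * y) (dv n).
rewrite /d mulrA mulfV ?fact_rat_neq0 // mul1r => ->.
case: n => [|n] /=; first by rewrite mulr0 mul0r.
by rewrite factS natrM mulrA mulfK ?fact_rat_neq0.
Qed.

Lemma horner_pbernoulli_poly (n p : nat) (x : rat) :
  (pbernoulli_poly n p).[x]
  = \sum_(k < n.+1) 'C(n, k)%:R * pbernoulli k p * x ^+ (n - k).
Proof.
by rewrite horner_sum; apply: eq_bigr => k _; rewrite hornerZ hornerXn.
Qed.

Lemma horner_pbernoulli_poly0 (n p : nat) :
  (pbernoulli_poly n p).[0] = pbernoulli n p.
Proof.
rewrite horner_pbernoulli_poly big_ord_recr /= big1 => [|i _].
  by rewrite binn subnn expr0 mulr1 mul1r add0r.
by rewrite expr0n subn_eq0 leqNgt ltn_ord mulr0.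
Qed.

Lemma horner_pbernoulli_polyS (n p : nat) (x : rat) :
  (pbernoulli_poly n.+1 p).[x] =
    (x + p%:R) * (pbernoulli_poly n p).[x]
    - p.+1%:R ^+ 2 / p.+2%:R * (pbernoulli_poly n p.+1).[x].
Proof.
pose b k := pbernoulli k p.
(* The recurrence of the p-Bernoulli numbers, summed against binomial weights. *)
have shift : \sum_(k < n.+1) 'C(n, k)%:R * b k.+1 * x ^+ (n - k) =
    p%:R * (pbernoulli_poly n p).[x]
    - p.+1%:R ^+ 2 / p.+2%:R * (pbernoulli_poly n p.+1).[x].
  rewrite !horner_pbernoulli_poly !mulr_sumr -sumrB.
  by apply: eq_bigr => k _; rewrite /b /=; ring.
rewrite mulrDl -addrA -shift !horner_pbernoulli_poly mulr_sumr.
rewrite big_ord_recl [in RHS]big_ord_recl /= !bin0 !subn0 -addrA exprS.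
congr (_ + _); first by rewrite !mul1r.
(* Pascal's rule: the 'C(n, k.+1) half completes x B_{n,p}(x), its last term being zero; the other
   half is [shift]. *)
rewrite (eq_bigr (fun k : 'I_n.+1 =>
  'C(n, k.+1)%:R * b k.+1 * x ^+ (n - k) + 'C(n, k)%:R * b k.+1 * x ^+ (n - k))).
  rewrite big_split /=; congr (_ + _).
  rewrite big_ord_recr /= bin_small // !mul0r addr0.
  apply: eq_bigr => k _; rewrite /bump add1n -(subnSK (ltn_ord k)) exprS.
  by rewrite /b /=; ring.
by move=> k _; rewrite /bump add1n binS natrD subSS /b /=; ring.
Qed.

Lemma pbernoulli_poly_diff (n p : nat) (x : rat) :
  (pbernoulli_poly n p).[x + 1] =
    x ^+ n + p.+1%:R / p.+2%:R
      * ((pbernoulli_poly n p.+1).[x + 1] - (pbernoulli_poly n p.+1).[x]).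
Proof.
elim: n p => [|n IHn] p.
  by rewrite !horner_pbernoulli_poly !big_ord1 /= subrr mulr0 addr0 !mulr1.
rewrite !horner_pbernoulli_polyS (exprS x) IHn.
(* The hypothesis at [p.+1] eliminates x^n; what remains is a rational identity in values of
   B_{n,p+1} and B_{n,p+2}. *)
have /(canRL (addrK _)) := esym (IHn p.+1).
move=> ->.
have := natrS_neq0 p.+2; have := natrS_neq0 p.+1.
rewrite -!natr1 => p2 p3.
by field; apply/andP; split.
Qed.

Theorem theorem3 :
  (forall n m p : nat,
     \sum_(k < m.+1) (pbernoulli_poly n p).[k.+1%:R] =
       ((bernoulli_poly n.+1).[m.+1%:R] - bernoulli n.+1) / n.+1%:R
       + p.+1%:R / p.+2%:R
         * ((pbernoulli_poly n p.+1).[m.+1%:R] - pbernoulli n p.+1))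
  /\
  (forall n m : nat,
     \sum_(k < m.+1) ((bernoulli_poly n).[k.+1%:R] + n%:R * k%:R ^+ n) =
       m.+1%:R * (bernoulli_poly n).[m.+1%:R]).
Proof.
split=> [n m p|n m].
  rewrite /bernoulli -horner_pbernoulli_poly0.
  pose F k := (bernoulli_poly n.+1).[k%:R] / n.+1%:R
    + p.+1%:R / p.+2%:R * (pbernoulli_poly n p.+1).[k%:R].
  rewrite -(big_mkord xpredT (fun k => (pbernoulli_poly n p).[k.+1%:R])).
  rewrite (@telescope_sumr_eq _ 0 m.+1 F) // => [|k _]; rewrite /F.
    by ring.
  rewrite -natr1 pbernoulli_poly_diff.
  (* Inserting the factor n+1 turns k^n into the increment of B_{n+1}/(n+1) at k. *)
  rewrite -[X in X + _ = _](mulKf (natrS_neq0 n)).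
  by rewrite -(bernoulli_poly_diff n.+1 k%:R); ring.
rewrite -(big_mkord xpredT (fun k =>
  (bernoulli_poly n).[k.+1%:R] + n%:R * k%:R ^+ n)).
(* The summand is the increment of k B_n(k), which vanishes at k = 0. *)
rewrite (@telescope_sumr_eq _ 0 m.+1
  (fun k => k%:R * (bernoulli_poly n).[k%:R])) ?mul0r ?subr0 // => k _.
have := bernoulli_poly_diff n k%:R; rewrite natr1.
move/(canRL (subrK _)) => ->; rewrite -natr1.
(* For positive n, k times k^(n-1) is k^n; for n = 0 both sides carry the factor 0. *)
by case: n => [|n] /=; rewrite ?exprS; ring.
Qed.
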